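(* Let $f,g,h:\mathcal{M}\to\mathbb{R}$ be lower semicontinuous convex functions on the closed convex set $\mathcal{M}=\mathcal{M}_1\times\cdots\times\mathcal{M}_n\subseteq\mathbb{R}^m$, where $f$ is $L$-smooth, $g(\bm{x})=\sum_{i=1}^n g_i(x_i)$ is block separable, and $h$ is continuously differentiable. Let $\phi=f+g-h$, and assume there is $\bm{x}_\star\in\mathcal{M}$ with $\phi^\star:=\phi(\bm{x}_\star)\le\phi(\bm{x})$ for all $\bm{x}\in\mathcal{M}$. Suppose $\bm{x}^1,\ldots,\bm{x}^K$ is a sequence generated by the randomized Block Coordinate DC Algorithm (BDCA) for solving $\min_{\bm{x}\in\mathcal{M}}\phi(\bm{x})$. Then $$\min_{k\in\{1,\ldots,K\}}\mathbb{E}\big[\mathrm{gap}^L_{\mathcal{M}}(\bm{x}^k)\big]\;\le\;\frac{n}{K}\big(\phi(\bm{x}^1)-\phi^\star\big).$$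
   Context: Blocks: the coordinates of $\mathbb{R}^m$ are partitioned into $n$ non-overlapping blocks of sizes $m_1,\dots,m_n$ with $\sum_i m_i=m$. For $\bm{x}\in\mathbb{R}^m$, $x_i\in\mathbb{R}^{m_i}$ is its $i$-th block, $\bm{x}_i\in\mathbb{R}^m$ is the vector with $i$-th block $x_i$ and zeros elsewhere, and $\bar{\bm{x}}_i=\bm{x}-\bm{x}_i$. The set $\mathcal{M}\subseteq\mathbb{R}^m$ is the product of sets $\mathcal{M}_i\subseteq\mathbb{R}^{m_i}$, so $\bm{x}\in\mathcal{M}$ iff $x_i\in\mathcal{M}_i$ for all $i$. $L$-smooth ($L\ge 0$): $f$ is differentiable and $\|\nabla f(\bm{x})-\nabla f(\bm{y})\|\le L\|\bm{x}-\bm{y}\|$ on $\mathcal{M}$; $\|\cdot\|$ is the Euclidean norm. BDCA: start from a (deterministic) point $\bm{x}^1\in\mathcal{M}$. For $k=1,\dots,K$: set $\bm{v}^k=\nabla h(\bm{x}^k)$; draw $i_k$ uniformly at random from $\{1,\dots,n\}$, independently of the previous draws; let $$x_{i_k}^{k+1}\in\arg\min_{x_{i_k}\in\mathcal{M}_{i_k}} f(\bm{x}_{i_k}+\bar{\bm{x}}^k_{i_k})+g_{i_k}(x_{i_k})-\langle v^k_{i_k},x_{i_k}\rangle$$ (a minimizer, assumed to exist); set $\bm{x}^{k+1}=\bm{x}^{k+1}_{i_k}+\bar{\bm{x}}^k_{i_k}$, i.e. only block $i_k$ changes. Gap function: for $\bm{y}\in\mathcal{M}$, $$\mathrm{gap}^L_{\mathcal{M}}(\bm{y})=\max_{\bm{x}\in\mathcal{M}}\Big\{\langle\nabla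 f(\bm{y})-\nabla h(\bm{y}),\bm{y}-\bm{x}\rangle+g(\bm{y})-g(\bm{x})-\tfrac{L}{2}\|\bm{x}-\bm{y}\|^2\Big\}$$ (read as a supremum if not attained). $\mathbb{E}$ is the expectation over all random block choices. *)

(* Defs.v *)
From mathcomp Require Export all_boot all_order all_algebra.
From mathcomp Require Export all_classical all_reals all_analysis.

Set Implicit Arguments.
Unset Strict Implicit.
Unset Printing Implicit Defensive.

Export Order.TTheory GRing.Theory Num.Theory.
Export numFieldNormedType.Exports.

Local Open Scope classical_set_scope.
Local Open Scope ring_scope.

(* The library norm on ['rV[R]_n] is the sup norm; it is only used here
   through the topology it induces. *)
Definition dot (R : realType) (n : nat) (u v : 'rV[R]_n) : R :=
  \sum_(j < n) u 0 j * v 0 j.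

Definition enorm (R : realType) (n : nat) (u : 'rV[R]_n) : R :=
  Num.sqrt (dot u u).

(* A function on [M] is a total function of which only the values on [M]
   matter: gradients and semicontinuity are relative to [M].  Such a gradient
   is unique as soon as [M] has nonempty interior; in general only its inner
   products with differences of points of [M] are determined. *)
Definition is_gradient (R : realType) (n : nat) (M : set 'rV[R]_n)
    (f : 'rV[R]_n -> R) (x v : 'rV[R]_n) : Prop :=
  (f y - f x - dot v (y - x)) / enorm (y - x) @[y --> within M x^'] --> (0 : R).

Definition gradient_on (R : realType) (n : nat) (M : set 'rV[R]_n)
    (f : 'rV[R]_n -> R) (df : 'rV[R]_n -> 'rV[R]_n) : Prop :=
  forall x, M x -> is_gradient M f x (df x).

Definition smooth_on (R : realType) (n : nat) (M : set 'rV[R]_n) (L : R)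
    (f : 'rV[R]_n -> R) (df : 'rV[R]_n -> 'rV[R]_n) : Prop :=
  gradient_on M f df /\
  forall x y, M x -> M y -> enorm (df x - df y) <= L * enorm (x - y).

Definition continuously_differentiable_on (R : realType) (n : nat)
    (M : set 'rV[R]_n) (h : 'rV[R]_n -> R) (dh : 'rV[R]_n -> 'rV[R]_n) : Prop :=
  gradient_on M h dh /\ {within M, continuous dh}.

Definition lsc_on (R : realType) (n : nat) (M : set 'rV[R]_n)
    (f : 'rV[R]_n -> R) : Prop :=
  lower_semicontinuous (fun x : subspace M => (f x)%:E).

Definition block_product (R : realType) (n : nat) (m_ : 'I_n -> nat)
    (M_ : forall i, set 'rV[R]_(m_ i)) : set 'rV[R]_(\sum_i m_ i) :=
  [set x | forall i, M_ i (submxrow x i)].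

Definition embed_block (R : realType) (n : nat) (m_ : 'I_n -> nat) (i : 'I_n)
    (u : 'rV[R]_(m_ i)) : 'rV[R]_(\sum_i m_ i) :=
  \mxrow_j eqtype.dfwith (fun j => 0 : 'rV[R]_(m_ j)) u j.

Definition off_block (R : realType) (n : nat) (m_ : 'I_n -> nat)
    (x : 'rV[R]_(\sum_i m_ i)) (i : 'I_n) : 'rV[R]_(\sum_i m_ i) :=
  x - embed_block (submxrow x i).

Definition is_argmin (R : realType) (T : Type) (D : set T) (F : T -> R)
    (u : T) : Prop :=
  D u /\ forall u', D u' -> F u <= F u'.

Definition bdca_step (R : realType) (n : nat) (m_ : 'I_n -> nat)
    (M_ : forall i, set 'rV[R]_(m_ i)) (f : 'rV[R]_(\sum_i m_ i) -> R)
    (g_ : forall i, 'rV[R]_(m_ i) -> R)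
    (dh : 'rV[R]_(\sum_i m_ i) -> 'rV[R]_(\sum_i m_ i))
    (x : 'rV[R]_(\sum_i m_ i)) (i : 'I_n) (x' : 'rV[R]_(\sum_i m_ i)) : Prop :=
  exists2 u : 'rV[R]_(m_ i),
    is_argmin (M_ i)
      (fun u => f (embed_block u + off_block x i) + g_ i u
                - dot (submxrow (dh x) i) u) u
    & x' = embed_block u + off_block x i.

(* The draws are the only source of randomness: the last clause says that the
   [k]-th iterate, including the choice among several minimizers, is determined
   by the draws [1 .. k-1]. *)
Definition bdca_run (R : realType) (n : nat) (m_ : 'I_n -> nat)
    (M_ : forall i, set 'rV[R]_(m_ i)) (f : 'rV[R]_(\sum_i m_ i) -> R)
    (g_ : forall i, 'rV[R]_(m_ i) -> R)
    (dh : 'rV[R]_(\sum_i m_ i) -> 'rV[R]_(\sum_i m_ i))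
    (K : nat) (x1 : 'rV[R]_(\sum_i m_ i)) (Omega : Type)
    (I : nat -> Omega -> 'I_n)
    (X : nat -> Omega -> 'rV[R]_(\sum_i m_ i)) : Prop :=
  [/\ forall w, X 1%N w = x1,
      forall k, (1 <= k <= K)%N ->
        forall w, bdca_step M_ f g_ dh (X k w) (I k w) (X k.+1 w)
    & forall k, (1 <= k <= K.+1)%N -> forall w w',
        (forall j, (1 <= j < k)%N -> I j w = I j w') -> X k w = X k w'].

Definition iid_uniform (R : realType) (n : nat) (d : measure_display)
    (Omega : measurableType d) (P : probability Omega R) (K : nat)
    (I : nat -> Omega -> 'I_n) : Prop :=
  [/\ forall k i, (1 <= k <= K)%N -> measurable (I k @^-1` [set i]),
      forall k i, (1 <= k <= K)%N -> P (I k @^-1` [set i]) = (n%:R^-1)%:E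
    & forall (J : seq nat) (A : nat -> set 'I_n),
        uniq J -> {in J, forall k, (1 <= k <= K)%N} ->
        P (\bigcap_(k in [set` J]) I k @^-1` A k)
          = (\prod_(k <- J) P (I k @^-1` A k))%E].

Definition gap (R : realType) (n : nat) (M : set 'rV[R]_n) (L : R)
    (g : 'rV[R]_n -> R) (df dh : 'rV[R]_n -> 'rV[R]_n) (y : 'rV[R]_n) : \bar R :=
  ereal_sup [set (dot (df y - dh y) (y - x) + g y - g x
                  - L / 2 * enorm (x - y) ^+ 2)%:E | x in M].

(* Main.v *)
Require Import Defs.
From mathcomp Require Import ring lra measurable_realfun.

(** Comparing the minimizer of block [i] with [z_i], the quadratic upper bound
    of [f] and the tangent lower bound of [h] show that an update of block [i]
    decreases [phi] by at least the [i]-th block of the expression maximized in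
    the gap at [z].  Summing over [i], the gap at [x] is at most the sum over
    [i] of the decreases, that is [n] times the expected decrease of one step;
    the expectations telescope.  The iterates depend only on the draws, which
    are uniform on the finite set ['I_n ^ K], so all expectations are averages
    over the functions [{ffun 'I_K -> 'I_n}]. *)

Local Open Scope classical_set_scope.
Local Open Scope ring_scope.

(** * Euclidean inner product and norm *)

Lemma dotE {R : realType} {n : nat} (u v : 'rV[R]_n) :
  dot u v = (u *m v^T) 0 0.
Proof. by rewrite mxE; apply: eq_bigr => j _; rewrite mxE. Qed.

Lemma dotC {R : realType} {n : nat} (u v : 'rV[R]_n) : dot u v = dot v u.
Proof. by apply: eq_bigr => j _; rewrite mulrC. Qed.

Lemma dotDl {R : realType} {n : nat} (u v w : 'rV[R]_n) :
  dot (u + v) w = dot u w + dot v w.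
Proof. by rewrite !dotE mulmxDl mxE. Qed.

Lemma dotZl {R : realType} {n : nat} (a : R) (u w : 'rV[R]_n) :
  dot (a *: u) w = a * dot u w.
Proof. by rewrite !dotE -scalemxAl mxE. Qed.

Lemma dotNl {R : realType} {n : nat} (u w : 'rV[R]_n) :
  dot (- u) w = - dot u w.
Proof. by rewrite -scaleN1r dotZl mulN1r. Qed.

Lemma dotBl {R : realType} {n : nat} (u v w : 'rV[R]_n) :
  dot (u - v) w = dot u w - dot v w.
Proof. by rewrite dotDl dotNl. Qed.

Lemma dotBr {R : realType} {n : nat} (u v w : 'rV[R]_n) :
  dot u (v - w) = dot u v - dot u w.
Proof. by rewrite !(dotC u) dotBl. Qed.

Lemma dotZr {R : realType} {n : nat} (a : R) (u w : 'rV[R]_n) :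
  dot u (a *: w) = a * dot u w.
Proof. by rewrite !(dotC u) dotZl. Qed.

Lemma dot_ge0 {R : realType} {n : nat} (u : 'rV[R]_n) : 0 <= dot u u.
Proof. by apply: sumr_ge0 => j _; rewrite -expr2 sqr_ge0. Qed.

Lemma dot_eq0 {R : realType} {n : nat} (u : 'rV[R]_n) :
  (dot u u == 0) = (u == 0).
Proof.
apply/idP/eqP => [|->]; last by rewrite dotE mul0mx mxE.
rewrite psumr_eq0 => [/allP u0|j _]; last by rewrite -expr2 sqr_ge0.
apply/rowP => j; rewrite mxE; apply/eqP.
by have := u0 j; rewrite mem_index_enum mulf_eq0 orbb; apply.
Qed.

Lemma enorm_ge0 {R : realType} {n : nat} (u : 'rV[R]_n) : 0 <= enorm u.
Proof. exact: sqrtr_ge0. Qed.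

Lemma sqr_enorm {R : realType} {n : nat} (u : 'rV[R]_n) :
  enorm u ^+ 2 = dot u u.
Proof. exact/sqr_sqrtr/dot_ge0. Qed.

Lemma enorm_eq0 {R : realType} {n : nat} (u : 'rV[R]_n) :
  (enorm u == 0) = (u == 0).
Proof. by rewrite -sqrf_eq0 sqr_enorm dot_eq0. Qed.

Lemma enormZ {R : realType} {n : nat} (a : R) (u : 'rV[R]_n) :
  0 <= a -> enorm (a *: u) = a * enorm u.
Proof.
by move=> a0; rewrite /enorm dotZl dotZr mulrA -expr2 sqrtrM ?sqr_ge0//
  sqrtr_sqr ger0_norm.
Qed.

(** Cauchy-Schwarz: for nonzero vectors, the squared norm of [enorm v *: u - enorm u *: v] expands
    to [2 |u| |v| (|u| |v| - dot u v)], which is therefore nonnegative. *)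
Lemma dot_le_enorm {R : realType} {n : nat} (u v : 'rV[R]_n) :
  dot u v <= enorm u * enorm v.
Proof.
have [->|u0] := eqVneq u 0.
  by rewrite dotE mul0mx mxE mulr_ge0 ?enorm_ge0.
have [->|v0] := eqVneq v 0.
  by rewrite dotC dotE mul0mx mxE mulr_ge0 ?enorm_ge0.
have u_gt0 : 0 < enorm u by rewrite lt_def enorm_eq0 u0 enorm_ge0.
have v_gt0 : 0 < enorm v by rewrite lt_def enorm_eq0 v0 enorm_ge0.
rewrite -(ler_pM2l (mulr_gt0 u_gt0 v_gt0)).
have := dot_ge0 (enorm v *: u - enorm u *: v).
rewrite dotBl !dotBr !dotZl !dotZr -!sqr_enorm (dotC v u).
by move: (enorm u) (enorm v) (dot u v) => a b c; lra.
Qed.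

(** * Convexity along segments, tangent inequality and quadratic upper bound *)

Lemma convex_set_segment {R : realType} {n : nat} {M : set 'rV[R]_n}
    (x y : 'rV[R]_n) (t : R) :
  convex_set M -> M x -> M y -> 0 <= t <= 1 -> M (x + t *: (y - x)).
Proof.
move=> cM /mem_set Mx /mem_set My /andP[t0 t1].
have /set_mem := cM y x (Itv01 t0 t1) My Mx.
rewrite /conv /= /unstable.onem.
by rewrite scalerBl scale1r addrCA -scalerBr.
Qed.

Lemma convex_function_segment {R : realType} {n : nat} {M : set 'rV[R]_n}
    (f : 'rV[R]_n -> R) (x y : 'rV[R]_n) (t : R) :
  convex_function M f -> M x -> M y -> 0 <= t <= 1 ->
  f (x + t *: (y - x)) <= f x + t * (f y - f x).
Proof.
move=> cf /mem_set Mx /mem_set My /andP[t0 t1].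
have /= := cf (Itv01 t0 t1) y x My Mx.
have -> : conv (Itv01 t0 t1) (y : convex_lmodType 'rV[R]_n) x = x + t *: (y - x).
  by rewrite /conv /= /unstable.onem scalerBl scale1r addrCA -scalerBr.
by move/le_trans; apply; rewrite convRE /= /unstable.onem; lra.
Qed.

(** Convexity bounds the slope of [f] from [x] to [x + t *: (y - x)] by [f y - f x]; letting [t]
    tend to 0 from the right turns the slope into [dot v (y - x)]. *)
Lemma convex_ge_tangent {R : realType} {n : nat} {M : set 'rV[R]_n}
    {f : 'rV[R]_n -> R} {x y v : 'rV[R]_n} :
  convex_set M -> convex_function M f -> M x -> M y -> is_gradient M f x v ->
  f x + dot v (y - x) <= f y.
Proof.
move=> cM cf Mx My fv.
have [->|yx] := eqVneq y x.
  by rewrite subrr dotC dotE mul0mx mxE addr0.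
have yx0 : y - x != 0 by rewrite subr_eq0.
have nyx : enorm (y - x) != 0 by rewrite enorm_eq0.
(* The gradient is a limit over [M] without [x]. The path stays in [M] because [M] is convex and
   [t <= 1], and it avoids [x] because [t > 0] and [y != x]. *)
have path_cvg : (fun t : R => x + t *: (y - x)) t @[t --> 0^'+] --> within M x^'.
  move=> A Ax; change (\forall t \near 0^'+, A (x + t *: (y - x))).
  have cvgx : (fun t : R => x + t *: (y - x)) t @[t --> 0^'+] --> x.
    apply: cvg_at_right_filter.
    rewrite -[X in _ --> X]addr0 -(scale0r (y - x)).
    by apply: cvgD; [exact: cvg_cst|apply: cvgZr_tmp; exact: cvg_id].
  near=> t; have t0 : 0 < t by near: t; exact: nbhs_right_gt.
  have : M (x + t *: (y - x)).
    apply: convex_set_segment => //; rewrite (ltW t0).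
    by near: t; exact: nbhs_right_le.
  have : x + t *: (y - x) != x.
    by rewrite addrC -subr_eq0 addrK scaler_eq0 negb_or (gt_eqF t0).
  by near: t; exact: (cvgx _ Ax).
(* Multiplying by the constant [enorm (y - x)] leaves only [t] in the denominator; the limit is
   still 0. *)
have /cvgMl_tmp - /(_ (enorm (y - x))) := cvg_comp _ _ path_cvg fv.
rewrite mulr0 => slope_cvg.
rewrite -lerBrDl -subr_ge0; apply: (cvgr_to_le slope_cvg); near=> t.
have t0 : 0 < t by near: t; exact: nbhs_right_gt.
have t1 : t <= 1 by near: t; exact: nbhs_right_le.
have := @convex_function_segment _ _ M f x y t cf Mx My.
rewrite (ltW t0) t1 => /(_ isT) ft.
rewrite /= (addrC x) addrK enormZ ?(ltW t0)// dotZr.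
rewrite mulrC invfM -mulrA divfK// ler_pdivrMr//.
by move: ft; rewrite addrC; lra.
Unshelve. all: by end_near.
Qed.

(* Subdividing the segment into [N] pieces and applying the tangent inequality
   of the convex [f] at the right end of each piece gives the bound up to an
   error [O(1 / N)]; no derivative along the segment is needed. *)
Lemma smooth_le_quadratic {R : realType} {n : nat} {M : set 'rV[R]_n} {L : R}
    {f : 'rV[R]_n -> R} {df : 'rV[R]_n -> 'rV[R]_n} {x y : 'rV[R]_n} :
  0 <= L -> convex_set M -> convex_function M f -> smooth_on M L f df ->
  M x -> M y ->
  f y <= f x + dot (df x) (y - x) + L / 2 * enorm (y - x) ^+ 2.
Proof.
move=> L0 cM cf [gf lf] Mx My.
set e := y - x; set c := L * enorm e ^+ 2.
(* The error term is [c / N ^ 2] times [1 + ... + j]: the [i]-th piece costs [c * i / N ^ 2], its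
   gradient being taken at distance [i / N * enorm e] from [x]. *)
have subdivision (N j : nat) : (0 < N)%N -> (j <= N)%N ->
    f (x + (j%:R / N%:R) *: e) <=
    f x + j%:R / N%:R * dot (df x) e + c * (j%:R * (j%:R + 1)) / (2 * N%:R ^+ 2).
  move=> N0; elim: j => [_|j IH jN].
    by rewrite !mul0r scale0r mulr0 mul0r !addr0.
  have Np : 0 < N%:R :> R by rewrite ltr0n.
  have in01 i : (i <= N)%N -> 0 <= (i%:R / N%:R : R) <= 1.
    by move=> iN; rewrite divr_ge0//= ler_pdivrMr// mul1r ler_nat.
  set z := x + (j%:R / N%:R) *: e; set w := x + (j.+1%:R / N%:R) *: e.
  have Mz : M z by apply: convex_set_segment => //; exact/in01/ltnW.
  have Mw : M w by apply: convex_set_segment => //; exact/in01.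
  have zw : z - w = - (N%:R^-1 *: e).
    rewrite opprD addrACA subrr add0r -scalerBl -mulrBl -scaleNr -natr1.
    by congr (_ *: _); lra.
  have wx : enorm (w - x) = j.+1%:R / N%:R * enorm e.
    by rewrite /w (addrC x) addrK enormZ// divr_ge0.
  have := convex_ge_tangent cM cf Mw Mz (gf _ Mw).
  rewrite zw dotC dotNl dotZl dotC => tangent.
  (* Cauchy-Schwarz and the Lipschitz bound between [w] and [x]. *)
  have grad : dot (df w) e <= dot (df x) e + c * (j.+1%:R / N%:R).
    rewrite -lerBlDl -dotBl (le_trans (dot_le_enorm _ _))//.
    rewrite /c expr2 mulrA mulrAC ler_wpM2r ?enorm_ge0//.
    by rewrite (le_trans (lf _ _ Mw Mx))// wx mulrA mulrAC.
  have {}grad : N%:R^-1 * dot (df w) e <=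
      N%:R^-1 * (dot (df x) e + c * (j.+1%:R / N%:R)).
    by rewrite ler_wpM2l// invr_ge0 ler0n.
  have {}IH := IH (ltnW jN).
  rewrite (le_trans (y := f z + N%:R^-1 * dot (df w) e))//.
    by move: tangent; rewrite -/w -/z; lra.
  apply: le_trans (lerD IH grad) _.
  rewrite -natr1 le_eqVlt; apply/orP; left; apply/eqP.
  by field; rewrite gt_eqF.
rewrite -/e mulrAC -/c; apply/ler_addgt0Pr => eps eps0.
have c0 : 0 <= c by rewrite mulr_ge0// sqr_ge0.
(* At [j = N] the error is [c / 2 + c / (2 N)]; this choice of [N] makes the excess over [c / 2]
   smaller than [eps]. *)
have [N N0 Nc] : exists2 N, (0 < N)%N & c / eps < N%:R.
  exists (Num.Def.archi_bound (c / eps)).+1 => //.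
  by rewrite (lt_trans (archi_boundP _))// ?ltr_nat// divr_ge0// ltW.
have Np : 0 < N%:R :> R by rewrite ltr0n.
have := subdivision N N N0 (leqnn N).
rewrite divff ?gt_eqF// scale1r mul1r (addrC x) subrK => /le_trans; apply.
rewrite -!addrA !lerD2l.
rewrite (_ : _ / _ = c / 2 + c / N%:R / 2); last by field; rewrite gt_eqF.
rewrite ltr_pdivrMr// in Nc.
have : c / N%:R <= eps by rewrite ler_pdivrMr// mulrC ltW.
lra.
Qed.

(** * Block decomposition and replacement of a single block *)

Lemma dot_block {R : realType} {n : nat} {m_ : 'I_n -> nat}
    (u v : 'rV[R]_(\sum_i m_ i)) :
  dot u v = \sum_i dot (submxrow u i) (submxrow v i).
Proof.
rewrite dotE -{1}(submxrowK u) -(submxrowK v) tr_mxrow mul_mxrow_mxcol summxE.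
by apply: eq_bigr => i _; rewrite mxrowK dotE.
Qed.

(** This is the argument of [f] in the subproblem of [bdca_step], and also the form of the next
    iterate. *)
Definition replace_block {R : realType} {n : nat} {m_ : 'I_n -> nat}
    (x : 'rV[R]_(\sum_i m_ i)) {i : 'I_n} (u : 'rV[R]_(m_ i)) :=
  embed_block u + off_block x i.

Lemma submxrow_replace_in {R : realType} {n : nat} {m_ : 'I_n -> nat}
    (x : 'rV[R]_(\sum_i m_ i)) (i : 'I_n) (u : 'rV[R]_(m_ i)) :
  submxrow (replace_block x u) i = u.
Proof.
rewrite submxrowD submxrowB !mxrowK !eqtype.dfwith_in.
by rewrite subrr addr0.
Qed.

Lemma submxrow_replace_out {R : realType} {n : nat} {m_ : 'I_n -> nat}
    (x : 'rV[R]_(\sum_i m_ i)) (i j : 'I_n) (u : 'rV[R]_(m_ i)) :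
  i != j -> submxrow (replace_block x u) j = submxrow x j.
Proof.
move=> ij; rewrite submxrowD submxrowB !mxrowK !eqtype.dfwith_out//.
by rewrite subr0 add0r.
Qed.

Lemma block_product_replace {R : realType} {n : nat} {m_ : 'I_n -> nat}
    {M_ : forall i, set 'rV[R]_(m_ i)} {x : 'rV[R]_(\sum_i m_ i)} {i : 'I_n}
    {u : 'rV[R]_(m_ i)} :
  block_product M_ x -> M_ i u -> block_product M_ (replace_block x u).
Proof.
move=> Mx Mu j; have [<-|ij] := eqVneq i j.
  by rewrite submxrow_replace_in.
by rewrite submxrow_replace_out.
Qed.

Lemma dot_replace_block {R : realType} {n : nat} {m_ : 'I_n -> nat}
    (v x : 'rV[R]_(\sum_i m_ i)) (i : 'I_n) (u : 'rV[R]_(m_ i)) :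
  dot v (replace_block x u - x) = dot (submxrow v i) (u - submxrow x i).
Proof.
rewrite dot_block (bigD1 i)//= submxrowB submxrow_replace_in big1 ?addr0// => j.
by rewrite eq_sym => ij; rewrite submxrowB submxrow_replace_out// subrr
  dotE trmx0 mulmx0 mxE.
Qed.

Lemma sum_replace_block {R : realType} {n : nat} {m_ : 'I_n -> nat}
    (g_ : forall i, 'rV[R]_(m_ i) -> R) (x : 'rV[R]_(\sum_i m_ i)) (i : 'I_n)
    (u : 'rV[R]_(m_ i)) :
  \sum_j g_ j (submxrow (replace_block x u) j) =
  \sum_j g_ j (submxrow x j) + (g_ i u - g_ i (submxrow x i)).
Proof.
rewrite (bigD1 i)//= submxrow_replace_in [in RHS](bigD1 i)//=.
rewrite [X in _ + X = _](eq_bigr (fun j => g_ j (submxrow x j))); first by ring.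
by move=> j; rewrite eq_sym => ij; rewrite submxrow_replace_out.
Qed.

(** * Decrease of the objective in one step, and its relation to the gap *)

Lemma bdca_step_mem {R : realType} {n : nat} {m_ : 'I_n -> nat}
    {M_ : forall i, set 'rV[R]_(m_ i)} {f : 'rV[R]_(\sum_i m_ i) -> R}
    {g_ : forall i, 'rV[R]_(m_ i) -> R}
    {dh : 'rV[R]_(\sum_i m_ i) -> 'rV[R]_(\sum_i m_ i)}
    {x x' : 'rV[R]_(\sum_i m_ i)} {i : 'I_n} :
  bdca_step M_ f g_ dh x i x' -> block_product M_ x -> block_product M_ x'.
Proof. by case=> u [Mu _] -> Mx; exact: block_product_replace. Qed.

Lemma bdca_step_decrease {R : realType} {n : nat} {m_ : 'I_n -> nat}
    {M_ : forall i, set 'rV[R]_(m_ i)} {L : R}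
    {f g h : 'rV[R]_(\sum_i m_ i) -> R} {g_ : forall i, 'rV[R]_(m_ i) -> R}
    {df dh : 'rV[R]_(\sum_i m_ i) -> 'rV[R]_(\sum_i m_ i)}
    {x x' z : 'rV[R]_(\sum_i m_ i)} {i : 'I_n} :
  0 <= L -> convex_set (block_product M_) ->
  convex_function (block_product M_) f -> smooth_on (block_product M_) L f df ->
  convex_function (block_product M_) h -> gradient_on (block_product M_) h dh ->
  (forall y, block_product M_ y -> g y = \sum_i g_ i (submxrow y i)) ->
  bdca_step M_ f g_ dh x i x' -> block_product M_ x -> block_product M_ z ->
  dot (submxrow (df x - dh x) i) (submxrow (x - z) i)
    + (g_ i (submxrow x i) - g_ i (submxrow z i))
    - L / 2 * enorm (submxrow (z - x) i) ^+ 2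
  <= (f x + g x - h x) - (f x' + g x' - h x').
Proof.
move=> L0 cM cf sf ch gh sg step Mx Mz.
have Mx' := bdca_step_mem step Mx.
case: step => u [_ umin] x'E; rewrite -/(replace_block x u) in x'E; subst x'.
(* The competitor is [x] with block [i] taken from [z]. The quadratic bound is applied there, and
   minimality carries it over to [x']. *)
have fz := smooth_le_quadratic L0 cM cf sf Mx (block_product_replace Mx (Mz i)).
(* The slope [dh x] is that of the linear term of the subproblem, so the inner products with [u]
   cancel when this is added to the minimality of [u]. *)
have hx' := convex_ge_tangent cM ch Mx Mx' (gh _ Mx).
have := umin _ (Mz i); rewrite -!/(replace_block x _).
rewrite (sg _ Mx) (sg _ Mx') sum_replace_block.
rewrite sqr_enorm !dot_replace_block submxrowB submxrow_replace_in in fz.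
rewrite dot_replace_block in hx'.
rewrite sqr_enorm !submxrowB; move: fz hx'; rewrite !dotBr !dotBl.
rewrite !(dotC (submxrow x i) (submxrow z i)).
lra.
Qed.

(** The points [x' i] are the possible successors of the same [x], one for each draw. One [z] serves
    as competitor for all blocks, and the resulting bound does not involve [z], so it passes to the
    supremum. *)
Lemma gap_le_sum_decrease {R : realType} {n : nat} {m_ : 'I_n -> nat}
    {M_ : forall i, set 'rV[R]_(m_ i)} {L : R}
    {f g h : 'rV[R]_(\sum_i m_ i) -> R} {g_ : forall i, 'rV[R]_(m_ i) -> R}
    {df dh : 'rV[R]_(\sum_i m_ i) -> 'rV[R]_(\sum_i m_ i)}
    {x : 'rV[R]_(\sum_i m_ i)} {x' : 'I_n -> 'rV[R]_(\sum_i m_ i)} :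
  0 <= L -> convex_set (block_product M_) ->
  convex_function (block_product M_) f -> smooth_on (block_product M_) L f df ->
  convex_function (block_product M_) h -> gradient_on (block_product M_) h dh ->
  (forall y, block_product M_ y -> g y = \sum_i g_ i (submxrow y i)) ->
  (forall i, bdca_step M_ f g_ dh x i (x' i)) -> block_product M_ x ->
  (gap (block_product M_) L g df dh x <=
   (\sum_i ((f x + g x - h x) - (f (x' i) + g (x' i) - h (x' i))))%:E)%E.
Proof.
move=> L0 cM cf sf ch gh sg step Mx; apply: ub_ereal_sup => _ [z Mz <-].
rewrite lee_fin; apply: (@le_trans _ _ (\sum_i
    (dot (submxrow (df x - dh x) i) (submxrow (x - z) i)
    + (g_ i (submxrow x i) - g_ i (submxrow z i))
    - L / 2 * enorm (submxrow (z - x) i) ^+ 2))); last first.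
  apply: ler_sum => i _.
  exact: (bdca_step_decrease L0 cM cf sf ch gh sg (step i) Mx Mz).
(* Inner product, squared norm and [g] are all sums over blocks, so the block terms add up to the
   expression inside the gap. *)
rewrite sumrB !big_split/= sumrN -mulr_sumr -dot_block -!sg//.
rewrite sqr_enorm (dot_block (z - x)).
rewrite (eq_bigr (fun i => enorm (submxrow (z - x) i) ^+ 2)) ?addrA// => i _.
by rewrite sqr_enorm.
Qed.

(** The candidate [x = y] contributes 0. Together with the upper bound, this makes the gap finite at
    the iterates. *)
Lemma gap_ge0 {R : realType} {n : nat} {M : set 'rV[R]_n} {L : R}
    {g : 'rV[R]_n -> R} {df dh : 'rV[R]_n -> 'rV[R]_n} {y : 'rV[R]_n} :
  M y -> (0 <= gap M L g df dh y)%E.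
Proof.
move=> My; apply: ereal_sup_ubound; exists y => //.
rewrite sqr_enorm subrr dotE trmx0 mulmx0 mxE dotE mul0mx mxE.
by congr (_%:E); ring.
Qed.

(** * Expectations as averages over sequences of draws *)

(** The integrand is a finite nonnegative combination of indicators of the fibres of [c], hence
    measurable as soon as these fibres are. *)
Lemma integral_finite_factor {R : realType} {d : measure_display}
    {Omega : measurableType d} (P : probability Omega R) {T : finType}
    (c : Omega -> T) (F : T -> R) :
  (forall t, measurable (c @^-1` [set t])) -> (forall t, 0 <= F t) ->
  (\int[P]_w (F (c w))%:E = \sum_t (F t)%:E * P (c @^-1` [set t]))%E.
Proof.
move=> mc F0.
have FE w : ((F (c w))%:E = \sum_t (F t * \1_(c @^-1` [set t]) w)%:E)%E.
  rewrite sumEFin (bigD1 (c w))//= big1 => [|t tc].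
    by rewrite indicE mem_set// mulr1 addr0.
  by rewrite indicE memNset ?mulr0// => /= wt; rewrite wt eqxx in tc.
under eq_integral do rewrite FE.
rewrite ge0_integral_sum//.
- apply: eq_bigr => t _.
  rewrite (integralZl_indic measurableT (fun=> c @^-1` [set t]))//.
    by rewrite integral_indic// setIT.
  by move=> /lt_geF; rewrite F0.
- move=> t; apply/measurable_EFinP/measurable_funM => //.
- by move=> t w _; rewrite lee_fin mulr_ge0.
Qed.

(** Draws are numbered from 1 and the elements of ['I_K] from 0, hence the shift. *)
Definition draws {n : nat} {Omega : Type} (I : nat -> Omega -> 'I_n) (K : nat)
  (w : Omega) : {ffun 'I_K -> 'I_n} := [ffun j : 'I_K => I j.+1 w].

(** This brings the event into the form required by the independence clause. For [1 <= k <= K] the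
    set of admissible [i] is a singleton; the quantifier over [j] avoids converting [k] into an
    ordinal. *)
Lemma draws_preimage {n : nat} {Omega : Type} (I : nat -> Omega -> 'I_n)
    {K : nat} (p : {ffun 'I_K -> 'I_n}) :
  draws I K @^-1` [set p] =
  \bigcap_(k in [set` iota 1 K])
    I k @^-1` [set i | forall j : 'I_K, j.+1 = k -> i = p j].
Proof.
apply/seteqP; split => w /=.
  by move=> <- k _ j <- /=; rewrite ffunE.
move=> wp; apply/ffunP => j; rewrite ffunE; apply: (wp j.+1) => //=.
by rewrite mem_iota /= add1n ltnS.
Qed.

Lemma iid_uniform_draws {R : realType} {n : nat} {d : measure_display}
    {Omega : measurableType d} {P : probability Omega R} {K : nat}
    {I : nat -> Omega -> 'I_n} (p : {ffun 'I_K -> 'I_n}) :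
  iid_uniform P K I ->
  measurable (draws I K @^-1` [set p]) /\
  P (draws I K @^-1` [set p]) = ((n%:R^-1) ^+ K)%:E.
Proof.
case=> mI PI indep; rewrite draws_preimage.
set A := fun k => [set i | forall j : 'I_K, j.+1 = k -> i = p j].
have inK k : k \in iota 1 K -> (1 <= k <= K)%N by rewrite mem_iota.
have AE k : k \in iota 1 K -> exists i, A k = [set i].
  case: k => [|k] /inK//= kK; exists (p (Ordinal kK)).
  apply/seteqP; split => i /=; first by apply.
  by move=> -> j [jk]; congr (p _); apply: val_inj.
split.
  apply: fin_bigcap_measurable => // k /= kK.
  by have [i Ai] := AE _ kK; rewrite -/(A k) Ai; apply/mI/inK.
rewrite (indep _ A) ?iota_uniq//.
rewrite (eq_big_seq (fun=> (n%:R^-1)%:E)); last first.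
  by move=> k kK; have [i ->] := AE _ kK; apply/PI/inK.
rewrite big_const_seq count_predT size_iota.
by elim: K {p A inK AE mI PI indep} => //= k ->; rewrite exprS EFinM.
Qed.

(** Resampling one draw with the others kept makes all possible outcomes of a single step available
    from the same iterate. *)
Definition redraw {n K : nat} (p : {ffun 'I_K -> 'I_n}) (k : 'I_K) (i : 'I_n) :
  {ffun 'I_K -> 'I_n} := [ffun j => if j == k then i else p j].

(* [(p, i) |-> (redraw p k i, p k)] is an involution. *)
Lemma sum_redraw {R : realType} {n K : nat} (k : 'I_K)
    (F : {ffun 'I_K -> 'I_n} -> R) :
  \sum_p \sum_i F (redraw p k i) = n%:R * \sum_p F p.
Proof.
have swapK : involutive
    (fun q : {ffun 'I_K -> 'I_n} * 'I_n => (redraw q.1 k q.2, q.1 k)).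
  move=> [p i] /=; rewrite !ffunE eqxx; congr (_, _).
  by apply/ffunP => j; rewrite !ffunE; case: eqP => // ->.
rewrite pair_bigA/= (reindex_inj (inv_inj swapK))/=.
rewrite -(pair_bigA _ (fun p i => F (redraw (redraw p k i) k (p k))))/=.
rewrite mulr_sumr; apply: eq_bigr => p _.
(* Redrawing coordinate [k] and then restoring it gives back [p], so the summand is constant in
   [i]. *)
rewrite (eq_bigr (fun=> F p)) => [|i _].
  by rewrite sumr_const card_ord mulr_natl.
by congr F; apply/ffunP => j; rewrite !ffunE; case: eqP => // ->.
Qed.

(** * Expected gap against the expected decrease of one random step *)

(** The range includes the iterate [K.+1], which ends the telescoping sum. *)
Lemma bdca_run_mem {R : realType} {n : nat} {m_ : 'I_n -> nat}
    {M_ : forall i, set 'rV[R]_(m_ i)} {f : 'rV[R]_(\sum_i m_ i) -> R}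
    {g_ : forall i, 'rV[R]_(m_ i) -> R}
    {dh : 'rV[R]_(\sum_i m_ i) -> 'rV[R]_(\sum_i m_ i)} {K : nat}
    {x1 : 'rV[R]_(\sum_i m_ i)} {Omega : Type} {I : nat -> Omega -> 'I_n}
    {X : nat -> Omega -> 'rV[R]_(\sum_i m_ i)} :
  bdca_run M_ f g_ dh K x1 I X -> block_product M_ x1 ->
  forall k w, (k <= K)%N -> block_product M_ (X k.+1 w).
Proof.
move=> [X1 step _] Mx1; elim=> [|k IH] w kK; first by rewrite X1.
exact: bdca_step_mem (step k.+1 kK w) (IH w (ltnW kK)).
Qed.

Lemma bdca_run_draws {R : realType} {n : nat} {m_ : 'I_n -> nat}
    {M_ : forall i, set 'rV[R]_(m_ i)} {f : 'rV[R]_(\sum_i m_ i) -> R}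
    {g_ : forall i, 'rV[R]_(m_ i) -> R}
    {dh : 'rV[R]_(\sum_i m_ i) -> 'rV[R]_(\sum_i m_ i)} {K : nat}
    {x1 : 'rV[R]_(\sum_i m_ i)} {Omega : Type} {I : nat -> Omega -> 'I_n}
    {X : nat -> Omega -> 'rV[R]_(\sum_i m_ i)} {k : nat} {w w' : Omega} :
  bdca_run M_ f g_ dh K x1 I X -> (k <= K)%N ->
  (forall j : 'I_K, (j < k)%N -> draws I K w j = draws I K w' j) ->
  X k.+1 w = X k.+1 w'.
Proof.
move=> [_ _ det] kK ww'; apply: det => // -[//|j] /=; rewrite ltnS => jk.
by have := ww' (Ordinal (leq_trans jk kK)) jk; rewrite !ffunE.
Qed.

(** Here [sample] picks one outcome for each sequence of draws, and [mean j] is the average of the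
    objective at the [j]-th iterate. Redrawing coordinate [k] keeps the iterate [k.+1] and runs
    through all its successors, so the sum of decreases over the blocks averages to [n] times the
    mean decrease. *)
Lemma expected_gap_le {R : realType} {n : nat} {m_ : 'I_n -> nat}
    {M_ : forall i, set 'rV[R]_(m_ i)} {L : R}
    {f g h : 'rV[R]_(\sum_i m_ i) -> R} {g_ : forall i, 'rV[R]_(m_ i) -> R}
    {df dh : 'rV[R]_(\sum_i m_ i) -> 'rV[R]_(\sum_i m_ i)} {K : nat}
    {x1 : 'rV[R]_(\sum_i m_ i)} {d : measure_display}
    {Omega : measurableType d} {P : probability Omega R}
    {I : nat -> Omega -> 'I_n} {X : nat -> Omega -> 'rV[R]_(\sum_i m_ i)}
    {sample : {ffun 'I_K -> 'I_n} -> Omega} {mean : nat -> R} (k : 'I_K) :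
  0 <= L -> convex_set (block_product M_) ->
  convex_function (block_product M_) f -> smooth_on (block_product M_) L f df ->
  convex_function (block_product M_) h -> gradient_on (block_product M_) h dh ->
  (forall y, block_product M_ y -> g y = \sum_i g_ i (submxrow y i)) ->
  block_product M_ x1 -> iid_uniform P K I -> bdca_run M_ f g_ dh K x1 I X ->
  (forall p, draws I K (sample p) = p) ->
  (forall j, mean j = n%:R^-1 ^+ K *
     \sum_p (f (X j (sample p)) + g (X j (sample p)) - h (X j (sample p)))) ->
  (\int[P]_w gap (block_product M_) L g df dh (X k.+1 w) <=
   (n%:R * (mean k.+1 - mean k.+2))%:E)%E.
Proof.
move=> L0 cM cf sf ch gh sg Mx1 PI run sampleK meanE.
have kK := ltnW (ltn_ord k).
set phi := fun y => f y + g y - h y.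
(* The iterate [k.+1] is determined by the coordinates before [k], which the redraw leaves alone;
   the redrawn coordinate decides which block is updated next. *)
have step p i : bdca_step M_ f g_ dh (X k.+1 (sample p)) i
    (X k.+2 (sample (redraw p k i))).
  have -> : X k.+1 (sample p) = X k.+1 (sample (redraw p k i)).
    apply: (bdca_run_draws run kK) => j jk.
    by rewrite !sampleK ffunE -val_eqE /= (ltn_eqF jk).
  have [_ /(_ k.+1 (ltn_ord k) (sample (redraw p k i)))] := run.
  suff -> : I k.+1 (sample (redraw p k i)) = i by [].
  have : draws I K (sample (redraw p k i)) k = i.
    by rewrite sampleK ffunE eqxx.
  by rewrite ffunE.
pose G p := gap (block_product M_) L g df dh (X k.+1 (sample p)).
have G_le p : (G p <= (\sum_i (phi (X k.+1 (sample p))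
                       - phi (X k.+2 (sample (redraw p k i)))))%:E)%E.
  apply: (gap_le_sum_decrease L0 cM cf sf ch gh sg (step p)).
  exact: (bdca_run_mem run).
have G_ge0 p : (0 <= G p)%E by apply/gap_ge0/(bdca_run_mem run).
have GE p : ((fine (G p))%:E = G p)%E.
  by rewrite fineK// ge0_fin_numE// (le_lt_trans (G_le p)) ?ltry.
(* The iterate at [w] equals the one at the sampled outcome with the same draws, so the integrand
   factors through the finite type of sequences. *)
rewrite (eq_integral (fun w => (fine (G (draws I K w)))%:E)); last first.
  move=> w _; rewrite GE /G; congr gap.
  by apply: (bdca_run_draws run kK) => j _; rewrite sampleK.
rewrite (integral_finite_factor P (draws I K) (fine \o G))//; first last.
- by move=> p; apply: fine_ge0.
- by move=> p; exact: (iid_uniform_draws p PI).1.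
rewrite (eq_bigr (fun p => (fine (G p) * n%:R^-1 ^+ K)%:E)); last first.
  by move=> p _; rewrite (iid_uniform_draws p PI).2 EFinM.
rewrite sumEFin lee_fin -mulr_suml mulrC.
rewrite !meanE -mulrBr mulrCA ler_wpM2l ?exprn_ge0 ?invr_ge0//.
(* Read from right to left, [sum_redraw] spreads the factor [n] over the redrawn blocks, so that
   both sides can be compared sequence by sequence. *)
rewrite mulrBr -(sum_redraw k (fun p => phi (X k.+2 (sample p)))).
rewrite mulr_sumr -sumrB; apply: ler_sum => p _.
rewrite -lee_fin GE (le_trans (G_le p))// lee_fin sumrB.
by rewrite sumr_const card_ord mulr_natl.
Qed.

(** * Telescoping of the mean decreases and selection of a good iterate *)

Theorem theorem3 (R : realType) (n : nat) (m_ : 'I_n -> nat)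
    (M_ : forall i : 'I_n, set 'rV[R]_(m_ i))
    (M : set 'rV[R]_(\sum_i m_ i))
    (hM : M = block_product M_)
    (hMclosed : closed M) (hMconvex : convex_set M)
    (f g h : 'rV[R]_(\sum_i m_ i) -> R)
    (hf_lsc : lsc_on M f) (hf_convex : convex_function M f)
    (hg_lsc : lsc_on M g) (hg_convex : convex_function M g)
    (hh_lsc : lsc_on M h) (hh_convex : convex_function M h)
    (L : R) (hL : 0 <= L)
    (df : 'rV[R]_(\sum_i m_ i) -> 'rV[R]_(\sum_i m_ i))
    (hf_smooth : smooth_on M L f df)
    (g_ : forall i : 'I_n, 'rV[R]_(m_ i) -> R)
    (hg_sep : forall x, M x -> g x = \sum_i g_ i (submxrow x i))
    (dh : 'rV[R]_(\sum_i m_ i) -> 'rV[R]_(\sum_i m_ i))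
    (hh_C1 : continuously_differentiable_on M h dh)
    (phi : 'rV[R]_(\sum_i m_ i) -> R)
    (hphi : forall x, phi x = f x + g x - h x)
    (xstar : 'rV[R]_(\sum_i m_ i)) (hxstar : M xstar)
    (hmin : forall x, M x -> phi xstar <= phi x)
    (K : nat) (hK : (0 < K)%N)
    (d : measure_display) (Omega : measurableType d) (P : probability Omega R)
    (I : nat -> Omega -> 'I_n) (hI : iid_uniform P K I)
    (x1 : 'rV[R]_(\sum_i m_ i)) (hx1 : M x1)
    (X : nat -> Omega -> 'rV[R]_(\sum_i m_ i))
    (hX : bdca_run M_ f g_ dh K x1 I X) :
  (\big[mine/+oo]_(1 <= k < K.+1) \int[P]_w gap M L g df dh (X k w)
    <= (n%:R / K%:R * (phi x1 - phi xstar))%:E)%E.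
Proof.
subst M.
have n_neq0 : n%:R != 0 :> R.
  (* A probability space has an outcome, and its first draw is an element of ['I_n]. *)
  have [w _] : [set: Omega] !=set0.
    apply/set0P/eqP => Omega0; have := probability_setT P.
    by rewrite Omega0 measure0 => -[] /eqP; rewrite eq_sym oner_eq0.
  by case: (I 1%N w) => i; rewrite pnatr_eq0; case: (n).
(* Each sequence of draws has probability [n ^- K], which is nonzero, so some outcome realizes
   it. *)
have /choice [sample sampleK] (p : {ffun 'I_K -> 'I_n}) :
    exists w, draws I K w = p.
  apply/set0P/eqP => p0; have := (iid_uniform_draws p hI).2.
  rewrite [X in P X]p0 measure0 => -[] /esym/eqP.
  by rewrite expf_eq0 invr_eq0 (negbTE n_neq0) andbF.
pose mean j := n%:R^-1 ^+ K * \sum_p (f (X j (sample p)) + g (X j (sample p))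
                                       - h (X j (sample p))).
have gap_mean (k : 'I_K) := expected_gap_le k hL hMconvex hf_convex hf_smooth
  hh_convex hh_C1.1 hg_sep hx1 hI hX sampleK (fun j => erefl (mean j)).
have mean_const (a : R) :
    n%:R^-1 ^+ K * \sum_(p : {ffun 'I_K -> 'I_n}) a = a.
  rewrite sumr_const card_ffun !card_ord -[a *+ _]mulr_natl natrX mulrA -exprMn mulVf//.
  by rewrite expr1n mul1r.
have mean_first : mean 1%N = phi x1.
  rewrite -[RHS]mean_const; congr (_ * _); apply: eq_bigr => p _.
  by have [-> _ _] := hX; rewrite -hphi.
have mean_last : phi xstar <= mean K.+1.
  rewrite -[leLHS]mean_const ler_wpM2l ?exprn_ge0 ?invr_ge0//.
  by apply: ler_sum => p _; rewrite -hphi; apply/hmin/(bdca_run_mem hX hx1).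
set B := n%:R / K%:R * _.
have BK : B * K%:R = n%:R * (phi x1 - phi xstar).
  by rewrite /B mulrAC divfK// pnatr_eq0 -lt0n.
clearbody B.
(* Otherwise all [K] terms exceed [B]. As [K > 0], their sum is then strictly above
   [B * K = n * (phi x1 - phi xstar)], whereas it telescopes to [n * (mean 1 - mean K.+1)], which is
   no larger than that. *)
have [k kB] : exists k : 'I_K, n%:R * (mean k.+1 - mean k.+2) <= B.
  apply: contrapT => noK.
  have : \sum_(1 <= k < K.+1) B <
         \sum_(1 <= k < K.+1) n%:R * (mean k - mean k.+1).
    apply: ltr_sum_nat => // -[//|k] /= kK; rewrite ltNge; apply/negP => kB.
    by apply: noK; exists (Ordinal (kK : (k < K)%N)).
  rewrite -mulr_sumr sumr_const_nat subn1 /= -[B *+ K]mulr_natr BK.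
  under eq_bigr do rewrite -opprB.
  rewrite sumrN telescope_sumr// opprB mean_first ltNge => /negP; apply.
  by rewrite ler_wpM2l// lerD2l lerN2.
have k_in : k.+1 \in index_iota 1 K.+1.
  by rewrite mem_index_iota; exact: (ltn_ord k).
(* A minimum started at [+oo] lies below each of its terms, so the single index [k.+1] suffices. *)
apply: (bigmin_inf_seq _ _ _ _ _ k_in) => //.
by apply: le_trans (gap_mean k) _; rewrite lee_fin.
Qed.
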